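(* Let $n\ge 3$ be an integer and let $K=\{213,132,231\}$. The number of equivalence classes of $S_n$ under $K$-equivalence is $2^{n-2}+2n-4$.
   Context: Permutations in $S_n$ are written as words $\pi_1\pi_2\cdots\pi_n$ in one-line notation. The order permutation of a word $u$ of $c$ distinct positive integers is the unique $\sigma\in S_c$ with $\sigma_i<\sigma_j$ iff $u_i<u_j$. A replacement partition $K$ of $S_c$ is a set partition of $S_c$; it is denoted by listing its parts with the one-element parts (and outer brackets) omitted, so here $K$ is the set partition of $S_3$ whose only part of size greater than one is $\{213,132,231\}$. The $K$-equivalence on $S_n$ is the equivalence relation generated by: $\phi\equiv\psi$ whenever $\phi=aub$ and $\psi=avb$ (concatenations) for some possibly empty words $a,b$ and words $u,v$ of length $c$ (so $u,v$ occupy the same $c$ consecutive positions) such that the order permutations of $u$ and $v$ lie in the same part of $K$. All equivalence classes are counted, including one-element classes. *)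

(* Defs.v *)
From mathcomp Require Import all_boot all_fingroup.

Set Implicit Arguments.
Unset Strict Implicit.
Unset Printing Implicit Defensive.

(* 'S_n acts on {0, ..., n-1}; words use the letters 1, ..., n. *)
Definition one_line (n : nat) (p : 'S_n) : seq nat :=
  [seq (val (p i)).+1 | i <- enum 'I_n].

Definition is_order_perm (c : nat) (u : seq nat) (s : 'S_c) : bool :=
  (size u == c) &&
  [forall i : 'I_c, forall j : 'I_c,
     (s i < s j) == (nth 0 u i < nth 0 u j)].

Definition same_part (c : nat) (K : {set {set 'S_c}}) (u v : seq nat) : bool :=
  [exists B in K, exists s in B, exists t in B,
     is_order_perm u s && is_order_perm v t].

(* phi = a u b and psi = a v b with |u| = |v| = c, where k = |a|; see K_stepP. *)
Definition K_step (c : nat) (K : {set {set 'S_c}}) (n : nat) : rel 'S_n :=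
  fun phi psi =>
    [exists k : 'I_n.+1,
      [&& k + c <= n,
          take k (one_line phi) == take k (one_line psi),
          drop (k + c) (one_line phi) == drop (k + c) (one_line psi)
        & same_part K (take c (drop k (one_line phi)))
                      (take c (drop k (one_line psi)))]].

(* [connect] is only the reflexive transitive closure; since K_step is
   symmetric (K_step_sym) this is the generated equivalence relation. *)
Definition K_equiv (c : nat) (K : {set {set 'S_c}}) (n : nat) : rel 'S_n :=
  connect (@K_step c K n).

Definition K_classes (c : nat) (K : {set {set 'S_c}}) (n : nat)
  : {set {set 'S_n}} :=
  equivalence_partition (@K_equiv c K n) [set: 'S_n].

Definition add_singletons (c : nat) (Q : {set {set 'S_c}}) : {set {set 'S_c}} :=
  Q :|: [set [set s] | s in ~: cover Q].

Definition perms_of_words (c : nat) (ws : seq (seq nat)) : {set 'S_c} :=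
  [set s : 'S_c | one_line s \in ws].

Definition K_213_132_231 : {set {set 'S_3}} :=
  add_singletons
    [set perms_of_words 3 [:: [:: 2; 1; 3]; [:: 1; 3; 2]; [:: 2; 3; 1]]].

Lemma size_one_line n (p : 'S_n) : size (one_line p) = n.
Proof. by rewrite size_map size_enum_ord. Qed.

Lemma K_stepP c (K : {set {set 'S_c}}) n (phi psi : 'S_n) :
  reflect
    (exists a u v b : seq nat,
       [/\ one_line phi = a ++ u ++ b, one_line psi = a ++ v ++ b,
           size u = c, size v = c & same_part K u v])
    (K_step K phi psi).
Proof.
have sz := @size_one_line n.
apply: (iffP existsP) => [[k /and4P[le_kc /eqP eqa /eqP eqb sp]]|].
  have split_word (p : 'S_n) : one_line p =
      take k (one_line p) ++ take c (drop k (one_line p))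
        ++ drop (k + c) (one_line p).
    by rewrite addnC -drop_drop !cat_take_drop.
  have szu (p : 'S_n) : size (take c (drop k (one_line p))) = c.
    by rewrite size_takel // size_drop sz leq_subRL ?(leq_trans (leq_addr c k)).
  exists (take k (one_line phi)), (take c (drop k (one_line phi))),
         (take c (drop k (one_line psi))), (drop (k + c) (one_line phi)).
  by split=> //; rewrite eqa eqb.
case=> a [u [v [b [Ephi Epsi szu szv sp]]]].
have szn : size a + (c + size b) = n by rewrite -szu -!size_cat -Ephi sz.
have lt_an : size a < n.+1 by rewrite ltnS -szn leq_addr.
exists (Ordinal lt_an); rewrite Ephi Epsi /= -{1}szn leq_add2l leq_addr /=.
rewrite addnC -!drop_drop !take_size_cat // !drop_size_cat //.
by rewrite !take_size_cat // !eqxx.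
Qed.

Lemma K_step_sym c (K : {set {set 'S_c}}) n : symmetric (@K_step c K n).
Proof.
suff sub phi psi : K_step K phi psi -> @K_step c K n psi phi.
  by move=> phi psi; apply/idP/idP; apply: sub.
case/K_stepP=> a [u [v [b [Ephi Epsi szu szv sp]]]].
apply/K_stepP; exists a, v, u, b; split=> //.
case/exists_inP: sp => B KB /exists_inP[s Bs /exists_inP[t Bt /andP[us vt]]].
apply/exists_inP; exists B => //; apply/exists_inP; exists t => //.
by apply/exists_inP; exists s; rewrite // vt us.
Qed.

Lemma K_equiv_rel c (K : {set {set 'S_c}}) n :
  equivalence_rel (@K_equiv c K n).
Proof.
apply/equivalence_relP; split=> [x|x y xy]; first exact: connect0.
by move=> z; apply: same_connect xy z; apply: sym_connect_sym; apply: K_step_sym.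
Qed.

Lemma add_singletons_partition c (Q : {set {set 'S_c}}) :
  trivIset Q -> set0 \notin Q -> partition (add_singletons Q) [set: 'S_c].
Proof.
move=> tQ Q0; apply/and3P; split.
- apply/eqP/setP=> s; rewrite inE; apply/bigcupP.
  have [/bigcupP[B QB Bs]|Qs] := boolP (s \in cover Q).
    by exists B; rewrite // inE QB.
  by exists [set s]; rewrite ?set11 // inE imset_f ?orbT // inE.
- apply/trivIsetP=> A B.
  rewrite !inE => /orP[QA|/imsetP[s Qs ->]] /orP[QB|/imsetP[t Qt ->]] neq.
  + exact: (trivIsetP tQ).
  + rewrite disjoint_sym disjoints1; move: Qt; rewrite inE.
    by apply: contra => At; apply/bigcupP; exists A.
  + rewrite disjoints1; move: Qs; rewrite inE.
    by apply: contra => Bs; apply/bigcupP; exists B.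
  + rewrite disjoints1 inE; apply: contra neq => /eqP ->; exact: eqxx.
- rewrite inE negb_or Q0; apply/imsetP=> -[s _ /setP/(_ s)].
  by rewrite !inE eqxx.
Qed.

Lemma one_line_surj n (w : seq nat) :
  perm_eq w (iota 1 n) -> exists p : 'S_n, one_line p = w.
Proof.
move=> pw; have szw : size w = n by rewrite (perm_size pw) size_iota.
have uw : uniq w by rewrite (perm_uniq pw) iota_uniq.
have w_bd (i : 'I_n) : 0 < nth 0 w i <= n.
  have: nth 0 w i \in w by rewrite mem_nth // szw.
  by rewrite (perm_mem pw) mem_iota add1n ltnS.
have lt_w (i : 'I_n) : (nth 0 w i).-1 < n.
  by case/andP: (w_bd i) => w0 wn; rewrite prednK.
have inj_w : injective (fun i : 'I_n => Ordinal (lt_w i)).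
  move=> i j /(congr1 val) /= /(congr1 succn).
  rewrite !prednK; try by [case/andP: (w_bd i) | case/andP: (w_bd j)].
  by move/eqP; rewrite nth_uniq ?szw // => /eqP/val_inj.
exists (perm inj_w); apply: (@eq_from_nth _ 0); rewrite size_one_line ?szw //.
move=> i lt_in; rewrite (nth_map (Ordinal lt_in)) ?size_enum_ord // permE /=.
rewrite nth_enum_ord // prednK //.
by case/andP: (w_bd (Ordinal lt_in)).
Qed.

Lemma K_213_132_231_partition : partition K_213_132_231 [set: 'S_3].
Proof.
apply: add_singletons_partition; first exact: trivIset1.
rewrite inE eq_sym; apply/set0Pn.
have [//|s Es] := @one_line_surj 3 [:: 2; 1; 3].
by exists s; rewrite inE Es.
Qed.

(* Main.v *)
From Stdlib Require Import Relation_Operators.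
Require Import Defs.
From mathcomp Require Import all_boot all_fingroup zify.

Set Implicit Arguments.
Unset Strict Implicit.
Unset Printing Implicit Defensive.

(** Permutations are handled as words. Call three consecutive letters loose if
    their order permutation is 213, 132 or 231: a move permutes the letters of a
    loose window so that it stays loose. The classes fall into two families.

    The words without a loose window are alone in their class. Their largest
    letter stands first or last, which gives by recursion 2^(n-2) of them
    besides the decreasing word ([mem_vwords], [size_vwords]).

    A leading largest letter is never moved and creates no loose window, so the
    longest prefix n, n-1, ..., m+1 of a word is an invariant and can be
    stripped, leaving the core, a word on 1, ..., m that does not begin with m.
    A movable core with N > M its two largest letters has type T if it reads
    M... or xNM...; a move preserves the type ([step_typeT]). Conversely any two
    movable cores on the same letters and of the same type are equivalent
    ([active_connected]), by induction on the number of letters: from four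
    letters on, type T words can be brought to begin with M and the others with a
    letter below M, the remainder being again active; induction classifies the remainders, and
    explicit chains of moves link the remainders of different types and the
    different leading letters. A core of length 3 has type T, and for m at least
    4 both types occur, whence (n-2) + (n-3) classes of movable words.

    In total 1 + 2^(n-2) + (n-2) + (n-3) classes: the pair made of the length and
    type of the core, or the word itself if it is not movable, is a complete
    invariant ([K_equiv_label]) and its values are listed in [labels]. *)

(** * Words and moves *)

(** The order permutation of x y z is one of 213, 132, 231. *)
Definition loose (x y z : nat) : bool :=
  [|| y < x < z, x < z < y | z < x < y].

(** Some window of three consecutive letters is loose; the words without such
    a window are the one-element classes. *)
Fixpoint movable (w : seq nat) : bool :=
  if w is x :: w' then
    (if w' is y :: z :: _ then loose x y z else false) || movable w'
  else false.

(** One move on words: a loose window is replaced by a loose rearrangement of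
    its letters. *)
Inductive step : seq nat -> seq nat -> Prop :=
| step_head x y z x' y' z' w :
    loose x y z -> loose x' y' z' -> perm_eq [:: x; y; z] [:: x'; y'; z'] ->
    step [:: x, y, z & w] [:: x', y', z' & w]
| step_cons x u v : step u v -> step (x :: u) (x :: v).

(** The equivalence relation generated by the moves. *)
Definition eqv := clos_refl_sym_trans (seq nat) step.

Lemma eqv_refl u : eqv u u. Proof. exact: rst_refl. Qed.
Lemma eqv_sym u v : eqv u v -> eqv v u. Proof. exact: rst_sym. Qed.
Lemma eqv_trans v u w : eqv u v -> eqv v w -> eqv u w.
Proof. exact: rst_trans. Qed.

Lemma eqv_cons x u v : eqv u v -> eqv (x :: u) (x :: v).
Proof.
elim=> {u v} [u v uv|u|u v _ IH|u v w _ IH1 _ IH2].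
- by apply: rst_step; apply: step_cons.
- exact: eqv_refl.
- exact: eqv_sym.
- exact: eqv_trans IH1 IH2.
Qed.

Lemma eqv_head x y z x' y' z' w :
    loose x y z -> loose x' y' z' -> perm_eq [:: x; y; z] [:: x'; y'; z'] ->
  eqv [:: x, y, z & w] [:: x', y', z' & w].
Proof. by move=> *; apply: rst_step; apply: step_head. Qed.

Lemma loose_peak x y z : x < y -> z < y -> x != z -> loose x y z.
Proof. by rewrite /loose; lia. Qed.

Lemma loose_213 x y z : y < x -> x < z -> loose x y z.
Proof. by rewrite /loose; lia. Qed.

(** Proves that two words are rearrangements of each other by counting the
    letters satisfying an arbitrary predicate, with the rearrangements among
    the hypotheses as linear equations. *)
Ltac perm_count :=
  let P := fresh "P" in apply/seq.permP; intro P;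
  repeat match goal with
  | H : is_true (perm_eq _ _) |- _ => move: (seq.permP H P); clear H
  end;
  rewrite /= ?count_cat /=; clear -P; lia.

(** * The two types of active words *)

(** [s] is an alphabet listed in decreasing order. A word on it is active when
    it is movable and does not begin with its largest letter. *)
Definition active (s w : seq nat) : bool :=
  [&& perm_eq w s, movable w & nth 0 w 0 != nth 0 s 0].

(** With N > M the two largest letters of [s], the word has type T when it reads
    M... or xNM..., for some letter x. Only words of at least three letters
    matter, so the default value 0 is not reached. *)
Definition typeT (s w : seq nat) : bool :=
  (nth 0 w 0 == nth 0 s 1)
  || (nth 0 w 1 == nth 0 s 0) && (nth 0 w 2 == nth 0 s 1).

Lemma gtn_trans : transitive gtn.
Proof. by move=> y x z /= xy yz; lia. Qed.

Lemma sorted_top N M L : sorted gtn [:: N, M & L] ->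
  [/\ M < N, forall x, x \in L -> x < M & uniq [:: N, M & L]].
Proof.
move=> sL; have uL := sorted_uniq gtn_trans ltnn sL.
case/andP: sL => MN sL; split=> // x xL.
by have /allP/(_ x xL) := order_path_min gtn_trans sL.
Qed.

Lemma sorted_rem N M L a : sorted gtn [:: N, M & L] ->
  sorted gtn [:: N, M & rem a L].
Proof.
apply: (subseq_sorted gtn_trans) => /=; rewrite !eqxx; exact: rem_subseq.
Qed.

Lemma active3_eqv s u v : size s = 3 -> active s u -> active s v -> eqv u v.
Proof.
move=> s3 /and3P[pu mu _] /and3P[pv mv _].
have := perm_size pu; have := perm_size pv; rewrite s3.
have puv : perm_eq u v by rewrite (perm_trans pu) // perm_sym.
move: u v puv mu mv {pu pv} => [|x [|y [|z [|? ?]]]] // [|x' [|y' [|z' [|? ?]]]] //=.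
move=> puv; rewrite !orbF => mu mv _ _.
exact: eqv_head.
Qed.

Lemma active3_typeT N M y w : sorted gtn [:: N; M; y] -> active [:: N; M; y] w ->
  typeT [:: N; M; y] w.
Proof.
case/sorted_top=> MN /(_ y (mem_head _ _)) yM _ /and3P[pw].
have: uniq w by rewrite (perm_uniq pw) /= !inE; lia.
move: (perm_size pw) (perm_mem pw).
move: w {pw} => [|a [|b [|c [|? ?]]]] //= _ mem; rewrite !inE => uw mw hw.
have ma : a \in [:: N; M; y] by rewrite -mem !inE eqxx.
have mb : b \in [:: N; M; y] by rewrite -mem !inE eqxx orbT.
have mc : c \in [:: N; M; y] by rewrite -mem !inE eqxx !orbT.
rewrite !inE in ma mb mc; rewrite /typeT /=.
have [//|aM] /= := eqVneq a M.
have {ma hw} /eqP ay : a == y by lia.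
have [bN|bN] := eqVneq b N; first by lia.
by move: mw; rewrite /loose; lia.
Qed.

(** An active word of type T can be brought to begin with M while its remainder
    stays active. *)
Lemma typeT_reduce N M L w : sorted gtn [:: N, M & L] -> 2 <= size L ->
  active [:: N, M & L] w -> typeT [:: N, M & L] w ->
  exists2 r, active (N :: L) r & eqv w (M :: r).
Proof.
move=> sL L2 /and3P[pw mw /= hw]; rewrite /typeT /= => Tw.
have [MN ML uL] := sorted_top sL.
have low x : x \in w -> (x == N) || (x <= M).
  by rewrite (perm_mem pw) !inE => /or3P[->|/eqP->|/ML/ltnW->]; rewrite ?leqnn ?orbT.
have := perm_size pw; have : uniq w by rewrite (perm_uniq pw).
case: w pw mw hw Tw low => [|a [|b [|c [|d w]]]] pw mw hw Tw low uw sw;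
  try by move: sw L2 => /=; clear; lia.
move: uw; rewrite /= !inE !negb_or.
case/and4P=> [/and4P[ab ac ad _] /and3P[bc bd _] /andP[cd _] _].
have [la lb lc ld]: [/\ (a == N) || (a <= M), (b == N) || (b <= M),
    (c == N) || (c <= M) & (d == N) || (d <= M)].
  by split; apply: low; rewrite !inE eqxx ?orbT.
move: Tw hw mw {low sw sL ML uL} => /=.
case/orP=> [/eqP aM|/andP[/eqP bN /eqP cM]] hw mw; last first.
  subst b c; exists [:: a, N, d & w].
    apply/and3P; split=> //; last first.
      by apply/orP; left; apply: loose_peak; lia.
    by perm_count.
  by apply: eqv_head; [apply: loose_peak; lia|apply: loose_213; lia|perm_count].
subst a; have [bN|bN] := eqVneq b N.
  subst b; exists [:: c, N, d & w].
    apply/and3P; split=> //; [by perm_count| |by rewrite eq_sym].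
    by apply/orP; left; apply: loose_peak; lia.
  by apply: eqv_head; [apply: loose_peak; lia|apply: loose_213; lia|perm_count].
exists [:: b, c, d & w]; last exact: eqv_refl.
apply/and3P; split=> //; first by perm_count.
have [B|//] := orP mw.
have [cN|cN] := eqVneq c N.
  by subst c; apply/orP; left; apply: loose_peak; lia.
by exfalso; move: B lb lc bN cN ac; rewrite /loose; clear; lia.
Qed.

(** After a leading M, an active remainder of type T is linked to one not of
    type T, as soon as the remainder has four letters:
    M q N t p ~ M N q t p ~ M N q p t ~ M q N p t. *)
Lemma typeT_join N M t q p z : sorted gtn [:: N, M, t, q, p & z] ->
  exists r1 r2, [/\ active [:: N, t, q, p & z] r1, typeT [:: N, t, q, p & z] r1,
    active [:: N, t, q, p & z] r2, ~~ typeT [:: N, t, q, p & z] r2 &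
    eqv (M :: r1) (M :: r2)].
Proof.
move=> sL; have [MN ML _] := sorted_top sL.
have tM : t < M by apply: ML; rewrite inE eqxx.
have [qt pq] : q < t /\ p < q by case/and5P: sL.
have [pt qM Nt] : [/\ p < t, q < M & t < N] by split; clear -tM qt pq MN; lia.
have [qN pM] : q < N /\ p < M by split; clear -qt Nt pq qM; lia.
exists [:: q, N, t, p & z], [:: q, N, p, t & z]; split.
- apply/and3P; split=> /=; [by perm_count| |by rewrite neq_ltn qN].
  by rewrite loose_peak // neq_ltn qt.
- by rewrite /typeT /= !eqxx orbT.
- apply/and3P; split=> /=; [by perm_count| |by rewrite neq_ltn qN].
  by rewrite loose_peak ?(ltn_trans pq) // neq_ltn pq orbT.
- by rewrite /typeT /= (ltn_eqF qt) (ltn_eqF pt) andbF.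
apply: (@eqv_trans [:: M, N, q, t, p & z]).
  by apply: eqv_head;
    [exact: loose_213|apply: loose_peak; rewrite // neq_ltn qM orbT|perm_count].
apply: (@eqv_trans [:: M, N, q, p, t & z]).
  do 2!apply: eqv_cons.
  by apply: eqv_head;
    [apply: loose_peak; rewrite // neq_ltn pq orbT|exact: loose_213|perm_count].
by apply: eqv_head;
  [apply: loose_peak; rewrite // neq_ltn qM orbT|exact: loose_213|perm_count].
Qed.

(** An active word not of type T can be brought to begin with a letter below the
    two largest, with an active remainder. *)
Lemma nontypeT_reduce N M L w : sorted gtn [:: N, M & L] -> 2 <= size L ->
  active [:: N, M & L] w -> ~~ typeT [:: N, M & L] w ->
  exists a r, [/\ a \in L, active [:: N, M & rem a L] r & eqv w (a :: r)].
Proof.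
move=> sL L2 /and3P[pw mw /= hw]; rewrite /typeT /= => Tw.
have [MN ML uL] := sorted_top sL.
have low x : x \in w -> (x <= N) && ((x == N) || (x <= M)).
  rewrite (perm_mem pw) !inE => /or3P[/eqP->|/eqP->|/ML xM].
  - by rewrite eqxx leqnn.
  - by rewrite leqnn orbT ltnW.
  - by rewrite ltnW ?(ltn_trans xM) // ltnW ?orbT.
have inL x : x \in w -> x != N -> x != M -> x \in L.
  by rewrite (perm_mem pw) !inE => /or3P[->|->|].
have remL x v : x \in L -> perm_eq w (x :: v) -> perm_eq v [:: N, M & rem x L].
  by move=> /perm_to_rem pL pv; perm_count.
suff [a [r [[wr aN aM] [rm rN ewr]]]] : exists a r,
    [/\ perm_eq w (a :: r), a != N & a != M] /\
    [/\ movable r, nth 0 r 0 != N & eqv w (a :: r)].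
  have aL : a \in L by apply: inL => //; rewrite (perm_mem wr) mem_head.
  by exists a, r; split=> //; apply/and3P; split=> //; apply: remL.
have := perm_size pw; have : uniq w by rewrite (perm_uniq pw).
case: w pw mw hw Tw low {inL remL} => [|a [|b [|c [|d w]]]] pw mw hw Tw low uw sw;
  try by move: sw L2 => /=; clear; lia.
move: uw; rewrite /= !inE !negb_or.
case/and4P=> [/and4P[ab ac ad _] /and3P[bc bd _] /andP[cd _] _].
have [/andP[la _] /andP[lb bM] /andP[lc _] /andP[ld _]]:
    [/\ (a <= N) && ((a == N) || (a <= M)), (b <= N) && ((b == N) || (b <= M)),
    (c <= N) && ((c == N) || (c <= M)) & (d <= N) && ((d == N) || (d <= M))].
  by split; apply: low; rewrite !inE eqxx ?orbT.
move: Tw hw {low sw sL ML uL pw}; rewrite /= negb_or => /andP[aM Tw] aN.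
(* If b exceeds a, c and d, moving the larger of a and c to the front leaves
   the peak b in second position of the remainder. *)
have peak : a < b -> c < b -> d < b -> c != M -> exists a' r,
    [/\ perm_eq [:: a, b, c, d & w] (a' :: r), a' != N & a' != M] /\
    [/\ movable r, nth 0 r 0 != N & eqv [:: a, b, c, d & w] (a' :: r)].
  move=> lt_ab lt_cb lt_db cM.
  have cN : c != N by rewrite neq_ltn (leq_trans lt_cb).
  have [lt_ac|] := ltnP a c.
    exists c, [:: a, b, d & w]; split; split=> //.
    - by perm_count.
    - by rewrite /= loose_peak.
    by apply: eqv_head; [exact: loose_peak|exact: loose_213|perm_count].
  rewrite leq_eqVlt eq_sym (negPf ac) => lt_ca.
  exists a, [:: c, b, d & w]; split; split=> //.
  - by perm_count.
  - by rewrite /= loose_peak.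
  by apply: eqv_head; [exact: loose_peak|exact: loose_213|perm_count].
have [bN|bN] := eqVneq b N.
  subst b; rewrite eqxx /= in Tw.
  by apply: peak; rewrite // ltn_neqAle ?aN ?la ?lc ?ld 1?eq_sym ?bc ?bd.
have [mr|mr] := boolP (movable [:: b, c, d & w]).
  by exists a, [:: b, c, d & w]; split; split=> //; apply: eqv_refl.
have B : loose a b c by case/orP: mw => // mr'; case/negP: mr.
have {mr} Nb : ~~ loose b c d by apply: contra mr => Bb; rewrite /= Bb.
have [lt_bc|] := ltnP b c.
  have [ba ac' cd'] : [/\ b < a, a < c & c < d].
    by move: B Nb ab ac ad bc bd cd lt_bc; clear; rewrite /loose; split; lia.
  exists a, [:: c, b, d & w]; split; split=> //; first by perm_count.
  - by rewrite /= loose_213.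
  - by rewrite /= neq_ltn (leq_trans cd').
  by apply: eqv_head; [exact: loose_213|apply: loose_peak|perm_count];
    rewrite // neq_ltn ba orbT.
move=> le_cb.
have [lt_ab lt_cb lt_db] : [/\ a < b, c < b & d < b].
  by move: B Nb ab ac ad bc bd cd le_cb; clear; rewrite /loose; split; lia.
apply: peak => //; rewrite neq_ltn (leq_trans lt_cb) //.
by move: bM; rewrite (negPf bN).
Qed.

(** * Active words of the same type are equivalent *)

(** Active words on [s] of the same type are equivalent. *)
Definition connected (s : seq nat) : Prop :=
  forall u v, active s u -> active s v -> typeT s u = typeT s v -> eqv u v.

Lemma typeT_connected N M L : sorted gtn [:: N, M & L] -> 2 <= size L ->
  connected (N :: L) ->
  forall u v, active [:: N, M & L] u -> active [:: N, M & L] v ->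
    typeT [:: N, M & L] u -> typeT [:: N, M & L] v -> eqv u v.
Proof.
move=> sL L2 IH u v au av Tu Tv.
have [r ar ur] := typeT_reduce sL L2 au Tu.
have [r' ar' vr'] := typeT_reduce sL L2 av Tv.
suff rr' : eqv (M :: r) (M :: r').
  by apply: eqv_trans ur _; apply: eqv_trans rr' _; apply: eqv_sym.
case: L L2 sL ar ar' IH {au av Tu Tv} => [//|t [//|q [|p z]]] _ sL ar ar' IH.
  (* A remainder of three letters always has type T. *)
  have sL' : sorted gtn [:: N; t; q].
    by case/and4P: sL => /= NM Mt tq _; rewrite tq (ltn_trans Mt NM).
  by apply: eqv_cons; apply: IH; rewrite // !active3_typeT.
have [r1 [r2 [a1 T1 a2 T2 r12]]] := typeT_join sL.
suff to1 x : active [:: N, t, q, p & z] x -> eqv (M :: x) (M :: r1).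
  by apply: eqv_trans (to1 _ ar) _; apply: eqv_sym; apply: to1.
move=> ax; have [Tx|Tx] := boolP (typeT [:: N, t, q, p & z] x).
  by apply: eqv_cons; apply: IH; rewrite ?Tx ?T1.
apply: eqv_trans (eqv_sym r12); apply: eqv_cons; apply: IH => //.
by rewrite (negPf Tx) (negPf T2).
Qed.

Lemma perm_to_rem2 (a b : nat) L : a \in L -> b \in L -> a != b ->
  perm_eq L [:: a, b & rem b (rem a L)].
Proof.
move=> aL bL ab; have pL := perm_to_rem aL.
apply: (perm_trans pL); rewrite perm_cons; apply: perm_to_rem.
by move: bL; rewrite (perm_mem pL) inE eq_sym (negPf ab).
Qed.

(** By the previous reduction only the words a r with r active matter. Those
    with r of type T are linked for different a by a M b N... ~ b M a N...; a
    remainder not of type T is turned into one of type T by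
    a y M N... ~ a M y N... when some y < a is available, and the least letter
    a is first exchanged with b < c by a c b N M... ~ b a c N M... *)
Lemma nontypeT_connected N M L : sorted gtn [:: N, M & L] -> 2 <= size L ->
  (forall a, a \in L -> connected [:: N, M & rem a L]) ->
  forall u v, active [:: N, M & L] u -> active [:: N, M & L] v ->
    ~~ typeT [:: N, M & L] u -> ~~ typeT [:: N, M & L] v -> eqv u v.
Proof.
move=> sL L2 IH u v au av Tu Tv.
have [a [r [aL ar ur]]] := nontypeT_reduce sL L2 au Tu.
have [b [r' [bL br' vr']]] := nontypeT_reduce sL L2 av Tv.
apply: eqv_trans ur _; apply: eqv_trans (eqv_sym vr').
clear dependent u; clear dependent v.
move: a b r r' aL bL ar br'.
pose s a := [:: N, M & rem a L].
have [MN ML uL] := sorted_top sL.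
have {}uL : uniq L by case/and3P: uL.
have remP a : a \in L -> perm_eq L (a :: rem a L) by apply: perm_to_rem.
have aMbN a b z : perm_eq L [:: a, b & z] ->
  active (s a) [:: M, b, N & z] /\ typeT (s a) [:: M, b, N & z].
  move=> pL; have aL : a \in L by rewrite (perm_mem pL) inE eqxx.
  have bM : b < M by apply: ML; rewrite (perm_mem pL) !inE eqxx orbT.
  split; last by rewrite /typeT /= eqxx.
  have pL' := remP _ aL.
  apply/and3P; split=> /=; [by perm_count|by rewrite loose_213|].
  by rewrite neq_ltn MN.
have joinT a b r r' : a \in L -> b \in L -> active (s a) r -> active (s b) r' ->
    typeT (s a) r -> typeT (s b) r' -> eqv (a :: r) (b :: r').
  move=> aL bL ar br' Tr Tr'.
  have [ab|ab] := eqVneq a b.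
    by subst b; apply: eqv_cons; apply: (IH a); rewrite ?Tr ?Tr'.
  have pab := perm_to_rem2 aL bL ab.
  set z := rem b (rem a L) in pab.
  have pba : perm_eq L [:: b, a & z] by perm_count.
  have [a1 T1] := aMbN _ _ _ pab; have [a2 T2] := aMbN _ _ _ pba.
  have aM := ML _ aL; have bM := ML _ bL.
  apply: (@eqv_trans [:: a, M, b, N & z]).
    by apply: eqv_cons; apply: (IH a); rewrite ?T1 ?Tr.
  apply: (@eqv_trans [:: b, M, a, N & z]).
    by apply: eqv_head; rewrite ?loose_peak // 1?eq_sym //; perm_count.
  by apply: eqv_cons; apply: (IH b); rewrite ?T2 ?Tr'.
have toT_lower a y r : a \in L -> y \in L -> y < a -> active (s a) r ->
    ~~ typeT (s a) r ->
    exists b r', [/\ b \in L, active (s b) r', typeT (s b) r' & eqv (a :: r) (b :: r')].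
  move=> aL yL ya ar Tr.
  have ay : a != y by rewrite neq_ltn ya orbT.
  have pL := perm_to_rem2 aL yL ay; move: (rem y (rem a L)) pL => z pL.
  have [a1 T1] := aMbN _ _ _ pL.
  have aM := ML _ aL; have yM := ML _ yL.
  exists a, [:: M, y, N & z]; split=> //.
  case: z pL a1 T1 => [|d z] pL a1 T1.
    (* With two letters below M the remainder has three letters, hence type T. *)
    have ra : rem a L = [:: y].
      apply/perm_small_eq => //; have := remP _ aL => pL'; perm_count.
    case/negP: Tr; rewrite /s ra; apply: active3_typeT.
      by rewrite /= MN yM.
    by move: ar; rewrite /s ra.
  have dM : d < M by apply: ML; rewrite (perm_mem pL) !inE eqxx !orbT.
  apply: (@eqv_trans [:: a, y, M, N, d & z]).
    apply: eqv_cons; apply: (IH a) => //.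
      have pL' := remP _ aL.
      apply/and3P; split=> /=; first by perm_count.
        by rewrite (@loose_peak M) ?orbT // ?(ltn_trans dM) // neq_ltn dM orbT.
      by rewrite neq_ltn (ltn_trans yM).
    by rewrite (negPf Tr) /typeT /= (ltn_eqF yM) (ltn_eqF MN).
  apply: eqv_head; first exact: loose_213.
    by apply: loose_peak.
  by perm_count.
have toT a r : a \in L -> active (s a) r ->
    exists b r', [/\ b \in L, active (s b) r', typeT (s b) r' & eqv (a :: r) (b :: r')].
  move=> aL ar; have [Tr|Tr] := boolP (typeT (s a) r).
    by exists a, r; split=> //; apply: eqv_refl.
  have [/hasP[y yL ya]|/hasPn amin] := boolP (has (fun y => y < a) L).
    exact: (toT_lower a y).
  have pL := remP _ aL.
  have srem := sorted_rem a sL.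
  have memr x : x \in rem a L -> x \in L by apply: mem_rem.
  have ltr x : x \in rem a L -> a < x.
    move=> xr; rewrite ltn_neqAle leqNgt amin ?memr // andbT eq_sym.
    by move: xr; rewrite mem_rem_uniq // inE => /andP[].
  case E: (rem a L) => [|c [|b z]].
  - by have := perm_size pL; rewrite E /= => sz; rewrite sz in L2.
  - case/negP: Tr; move: ar; rewrite /s E => ar.
    by apply: active3_typeT => //; rewrite -E.
  have cb : b < c by move: srem; rewrite E => /and4P[].
  have ab : a < b by apply: ltr; rewrite E !inE eqxx orbT.
  have bL : b \in L by apply: memr; rewrite E !inE eqxx orbT.
  have cL : c \in L by apply: memr; rewrite E !inE eqxx.
  have pL' := remP _ bL.
  have cM := ML _ cL; have bM := ML _ bL; have aM := ML _ aL.
  rewrite E in pL.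
  have ac := ltn_trans ab cb.
  have cN := ltn_trans cM MN.
  have a1 : active (s b) [:: a, c, N, M & z].
    apply/and3P; split=> /=; first by perm_count.
      by rewrite (@loose_peak c) ?orbT // neq_ltn cM.
    by rewrite neq_ltn (ltn_trans aM).
  have T1 : ~~ typeT (s b) [:: a, c, N, M & z].
    by rewrite /typeT /= (ltn_eqF aM) (ltn_eqF cN).
  have [b' [r' [b'L a' T' e']]] := toT_lower _ _ _ bL aL ab a1 T1.
  exists b', r'; split=> //; apply: eqv_trans e'.
  apply: (@eqv_trans [:: a, c, b, N, M & z]).
    apply: eqv_cons; apply: (IH a) => //.
      apply/and3P; split=> /=; first by rewrite /s E; perm_count.
        by rewrite loose_213 // (ltn_trans bM).
      by rewrite neq_ltn cN.
    by rewrite (negPf Tr) /typeT /= (ltn_eqF cM) (ltn_eqF (ltn_trans bM MN)).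
  apply: eqv_head; [apply: loose_peak|exact: loose_213|perm_count] => //.
  by rewrite neq_ltn ab.
move=> a b r r' aL bL ar br'.
have [a' [q [a'L aq Tq e]]] := toT _ _ aL ar.
have [b' [q' [b'L bq' Tq' e']]] := toT _ _ bL br'.
apply: eqv_trans e _; apply: eqv_trans (eqv_sym e'); exact: joinT.
Qed.

Lemma active_connected s : sorted gtn s -> 3 <= size s -> connected s.
Proof.
have [k] := ubnP (size s); elim: k s => // k IH [|N [|M L]] //= sk sL sz.
case: (ltnP 1 (size L)) => [L2|L1]; last first.
  move=> u v au av _; apply: active3_eqv au av => /=; lia.
move=> u v au av Tuv; have [Tu|Tu] := boolP (typeT [:: N, M & L] u).
  apply: (typeT_connected sL L2) => //; last by rewrite -Tuv.
  apply: IH; [by move: sk => /=; lia| |by []].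
  apply: (@subseq_sorted _ gtn gtn_trans _ [:: N, M & L] _ sL) => /=.
  by rewrite eqxx; exact: subseq_cons.
apply: (nontypeT_connected sL L2) => //; last by rewrite -Tuv.
move=> a aL; have szr := size_rem aL.
apply: IH; [|exact: (@sorted_rem N M L a sL)|];
  by move: sk L2; rewrite /= szr; clear; case: (size L).
Qed.

(** * A complete invariant of words *)

(** The alphabet 1, ..., n in decreasing order. *)
Definition letters (n : nat) : seq nat := rev (iota 1 n).

Lemma lettersS n : letters n.+1 = n.+1 :: letters n.
Proof. by rewrite /letters -{1}(addn1 n) iotaD rev_cat /= add1n. Qed.

Lemma size_letters n : size (letters n) = n.
Proof. by rewrite size_rev size_iota. Qed.

Lemma mem_letters n x : (x \in letters n) = (0 < x <= n).
Proof. by rewrite mem_rev mem_iota add1n ltnS. Qed.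

Lemma sorted_letters n : sorted gtn (letters n).
Proof. by rewrite rev_sorted; apply: iota_ltn_sorted. Qed.

Lemma sorted_perm_letters n w :
  sorted gtn w -> perm_eq w (letters n) -> w = letters n.
Proof.
move=> sw pw.
exact: (irr_sorted_eq gtn_trans ltnn sw (sorted_letters n) (perm_mem pw)).
Qed.

Lemma loose_ntop x y z : y <= x -> z <= x -> loose x y z = false.
Proof. by rewrite /loose; lia. Qed.

Lemma movable_top x w : (forall y, y \in w -> y <= x) ->
  movable (x :: w) = movable w.
Proof.
case: w => [|y [|z w]] // wx.
have [yx zx] : y <= x /\ z <= x by split; apply: wx; rewrite !inE eqxx ?orbT.
by rewrite {1}/movable -/movable loose_ntop.
Qed.

Lemma step_perm u v : step u v -> perm_eq u v.
Proof.
elim=> {u v} [x y z x' y' z' w _ _ p|x u v _ p]; last by rewrite perm_cons.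
by rewrite -[in X in perm_eq X _]cat1s -(cat1s x'); perm_count.
Qed.

Lemma step_movable u v : step u v -> movable u && movable v.
Proof.
elim=> {u v} [x y z x' y' z' w b b' _|x u v _ /andP[mu mv]] /=.
  by rewrite b b'.
by rewrite mu mv !orbT.
Qed.

(** A letter that bounds all the others is moved neither out of the first
    position nor into it, since no loose window begins with it. *)
Lemma step_top K u v : step u v -> (forall y, y \in u -> y <= K) ->
  (nth 0 u 0 == K) = (nth 0 v 0 == K).
Proof.
case=> {u v} // x y z x' y' z' w B B' p uK /=.
have le t : t \in [:: x; y; z] -> t <= K.
  by move=> tx; apply: uK; rewrite -[_ :: _]/([:: x; y; z] ++ w) mem_cat tx.
have ne a b c : loose a b c -> (forall t, t \in [:: a; b; c] -> t <= K) ->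
    (a == K) = false.
  move=> Ba leK; apply: contraTF Ba => /eqP aK.
  by rewrite loose_ntop // aK leK // !inE eqxx ?orbT.
by rewrite (ne _ _ _ B) // (ne _ _ _ B') // => t; rewrite -(perm_mem p); apply: le.
Qed.

Lemma step_typeT N M L u v : sorted gtn [:: N, M & L] ->
  perm_eq u [:: N, M & L] -> nth 0 u 0 != N -> step u v ->
  typeT [:: N, M & L] u = typeT [:: N, M & L] v.
Proof.
move=> sL pu hu; have [MN ML _] := sorted_top sL.
have low x : x \in u -> (x == N) || (x <= M).
  by rewrite (perm_mem pu) !inE => /or3P[->|/eqP->|/ML/ltnW->]; rewrite ?leqnn ?orbT.
have uN x : x \in u -> x <= N by move=> /low; clear -MN; lia.
have uu : uniq u by rewrite (perm_uniq pu) (sorted_uniq gtn_trans ltnn).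
move=> st; case: st pu hu low uN uu => {u v}.
  move=> x y z x' y' z' w B B' p _ hu low _ _.
  (* On a loose triple, type T means that both largest letters occur in it. *)
  have TE a b c : loose a b c ->
      (forall t, t \in [:: a; b; c] -> (t == N) || (t <= M)) ->
      typeT [:: N, M & L] [:: a, b, c & w] =
        (N \in [:: a; b; c]) && (M \in [:: a; b; c]).
    move=> Ba lw; rewrite /typeT /= !inE.
    have la : (a == N) || (a <= M) by apply: lw; rewrite !inE eqxx ?orbT.
    have lb : (b == N) || (b <= M) by apply: lw; rewrite !inE eqxx ?orbT.
    have lc : (c == N) || (c <= M) by apply: lw; rewrite !inE eqxx ?orbT.
    rewrite !(eq_sym N) !(eq_sym M).
    move: Ba la lb lc MN; rewrite /loose; clear.
    by case/or3P=> /andP[]; lia.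
  rewrite !TE ?(perm_mem p) // => t; rewrite -?(perm_mem p) => tx; apply: low;
    by rewrite -[_ :: _]/([:: x; y; z] ++ w) mem_cat tx.
move=> x u v st pu hu low uN uu; rewrite /typeT /=; congr (_ || _).
have uN' y : y \in u -> y <= N by move=> yu; apply: uN; rewrite inE yu orbT.
rewrite (step_top st uN'); have [vN|//] /= := eqVneq (nth 0 v 0) N.
have := step_top st uN'; rewrite vN eqxx => /eqP.
case: st vN uN' low uu {pu hu uN} => {u v}.
  move=> a b c a' b' c' w B B' p _ le _ _ /= aN.
  by move: B; rewrite loose_ntop // aN le // !inE eqxx ?orbT.
move=> y u v st /= _ _ low /and3P[_ yu _] yN; rewrite yN in yu.
apply: step_top st _ => t tu.
have /orP[/eqP tN|//] : (t == N) || (t <= M) by apply: low; rewrite !inE tu !orbT.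
by rewrite -tN tu in yu.
Qed.

(** On a rearrangement of 1, ..., n, strips the longest prefix of the form
    n, n-1, ..., m+1: the length of a word is its largest letter. *)
Fixpoint core (w : seq nat) : seq nat :=
  if w is x :: w' then if x == (size w').+1 then core w' else w else [::].

(** A word that is not movable is its own label; a movable word is labelled by
    the length of its core and by whether the core has type T. *)
Definition label (w : seq nat) : seq nat + nat * bool :=
  if movable w then
    inr (size (core w), typeT (letters (size (core w))) (core w))
  else inl w.

Lemma size_core w : size (core w) <= size w.
Proof. by elim: w => //= x w IH; case: ifP => // _; apply: leqW. Qed.

Lemma letters_head n x w : perm_eq (x :: w) (letters n) ->
  [/\ size w = n.-1, forall y, y \in x :: w -> y <= n &
      x = n -> perm_eq w (letters n.-1)].
Proof.
case: n => [|n] p; first by have := perm_size p.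
split.
- by move: (perm_size p); rewrite size_letters => -[].
- by move=> y; rewrite (perm_mem p) mem_letters => /andP[].
- by move=> xn; move: p; rewrite lettersS xn perm_cons.
Qed.

Lemma core_active n w : perm_eq w (letters n) -> movable w ->
  active (letters (size (core w))) (core w).
Proof.
elim: w n => // x w IH n p mw; have [sw le top] := letters_head p.
have n0 : 0 < n by have := perm_size p; rewrite size_letters => <-.
rewrite [core _]/=; case: eqP => [xn|xn].
  have {}xn : x = n by rewrite xn sw prednK.
  apply: IH (top xn) _; rewrite -(@movable_top x) // => y yw.
  by rewrite xn le // inE yw orbT.
have sxw : size (x :: w) = n by rewrite /= sw prednK.
rewrite sxw; apply/and3P; split=> //.
rewrite sw prednK // in xn.
by case: n n0 xn {IH p sw le top sxw} => // n _ /eqP; rewrite lettersS.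
Qed.

Lemma movable_size w : movable w -> 3 <= size w.
Proof. by case: w => [|x [|y [|z w]]]. Qed.

Lemma label_complete n u v : perm_eq u (letters n) -> perm_eq v (letters n) ->
  label u = label v -> eqv u v.
Proof.
rewrite /label; case: ifP => mu; case: ifP => mv // pu pv; last first.
  by case=> ->; apply: eqv_refl.
case=> sc tc; elim: n u v mu mv pu pv sc tc => [|n IH] u v.
  by move=> mu _ /perm_size/=; case: u mu.
case: u => // x u; case: v => // y v mu mv pu pv.
have [su leu topu] := letters_head pu; have [sv lev topv] := letters_head pv.
have := core_active pu mu; have := core_active pv mv.
rewrite /= su sv /= in topu topv *.
case: eqP => yn; case: eqP => xn av au sc tc.
- subst x y; apply: eqv_cons; apply: IH => //; try exact: topu; try exact: topv.
    by rewrite -(@movable_top n.+1) // => t tu; apply: leu; rewrite inE tu orbT.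
  by rewrite -(@movable_top n.+1) // => t tu; apply: lev; rewrite inE tu orbT.
- by move: (size_core v); rewrite -sc /= su sv /= ltnn.
- by move: (size_core u); rewrite sc /= su sv /= ltnn.
rewrite /= su sv /= in au av tc; apply: active_connected au av tc.
  exact: sorted_letters.
by rewrite size_letters -[n]/(n.+1.-1) -su; apply: movable_size mu.
Qed.

Lemma label_step n u v : perm_eq u (letters n) -> step u v -> label u = label v.
Proof.
move=> pu st; rewrite /label; have /andP[mu mv] := step_movable st.
rewrite mu mv; suff [-> ->] : size (core u) = size (core v) /\
  typeT (letters (size (core u))) (core u) = typeT (letters (size (core u))) (core v).
  by [].
elim: n u v pu st mu mv => [|n IH] u v pu st mu mv.
  by have := perm_size pu; case: u mu {pu st}.
have pv : perm_eq v (letters n.+1) by apply: perm_trans pu; rewrite perm_sym step_perm.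
have hd : (nth 0 u 0 == n.+1) = (nth 0 v 0 == n.+1).
  by apply: step_top st _ => y; rewrite (perm_mem pu) mem_letters => /andP[].
have [un|un] := eqVneq (nth 0 u 0) n.+1.
  move: hd; rewrite un eqxx => /esym/eqP vn.
  case: st un vn pu pv mu mv => {u v}.
    move=> x y z x' y' z' w B _ _ /= xn _ pu.
    have [_ le _] := letters_head pu.
    by move: B; rewrite loose_ntop // xn le // !inE eqxx ?orbT.
  move=> x u v st /= -> _ pu pv _ _.
  have [su leu topu] := letters_head pu; have [sv lev topv] := letters_head pv.
  rewrite su sv eqxx; have /andP[mu mv] := step_movable st.
  by apply: IH => //; apply: topu.
have vn : nth 0 v 0 != n.+1 by rewrite -hd.
have coreE w : perm_eq w (letters n.+1) -> nth 0 w 0 != n.+1 -> core w = w.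
  case: w => //= x w p xn; have [-> _ _] := letters_head p.
  by rewrite (negPf xn).
have su := perm_size pu; have sv := perm_size pv.
rewrite !coreE // su sv size_letters; split=> //.
have n2 : 2 <= n by have := movable_size mu; rewrite su size_letters.
case: n n2 {IH su sv coreE hd mu mv pv} pu un vn => // n _ pu un _.
have sl := sorted_letters n.+2.
rewrite !lettersS in pu sl *; exact: step_typeT sl pu un st.
Qed.

(** * Words without a loose window *)

Lemma movable_catl u v : movable u -> movable (u ++ v).
Proof.
elim: u => [|x [|y [|z u]] IH] //= /orP[->//|mu].
by rewrite [X in _ || X]IH ?orbT.
Qed.

Lemma movable_catr u v : movable v -> movable (u ++ v).
Proof. by elim: u => //= x u IH /IH ->; rewrite orbT. Qed.

Lemma sorted_movable_rcons w N : 2 <= size w -> sorted gtn w ->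
  (forall x, x \in w -> x < N) -> movable (rcons w N).
Proof.
elim: w => [|x [|y [|z w]] IH] // _ sw wN.
  case/andP: sw => yx _ /=; rewrite loose_213 // wN // inE eqxx //.
apply: (@movable_catr [:: x]); apply: IH => //; first by case/andP: sw.
by move=> t tw; apply: wN; rewrite inE tw orbT.
Qed.

Lemma immovable_rcons w N : uniq w -> ~~ movable w -> ~~ sorted gtn w ->
  (forall x, x \in w -> x < N) -> ~~ movable (rcons w N).
Proof.
elim: w => [|x [|y [|z w]] IH] //.
  rewrite /= !inE !andbT orbF => xy _ yx wN.
  by rewrite /loose /=; move: (wN x) (wN y); rewrite !inE !eqxx orbT; lia.
move=> uw mw sw wN.
have uw' : uniq [:: y, z & w] by case/andP: uw.
have [nb mw'] : ~~ loose x y z /\ ~~ movable [:: y, z & w].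
  by apply/andP; rewrite -negb_or.
rewrite -[rcons _ _]/([:: x, y, z & rcons w N]).
suff sw' : ~~ sorted gtn [:: y, z & w].
  have := IH uw' mw' sw' (fun t tw => wN t (@mem_behead _ [:: x, y, z & w] t tw)).
  by move=> mr; apply/norP.
apply: contra sw => sw'; have /andP[zy _] := sw'.
rewrite -[sorted _ _]/(gtn x y && sorted gtn [:: y, z & w]) sw' andbT /=.
case/and3P: uw; rewrite !inE !negb_or => /and3P[xy xz _] _ _.
by move: nb zy xy xz; rewrite /loose /=; clear; lia.
Qed.

(** In a word without loose window an interior largest letter is impossible,
    since it would be a peak. *)
Lemma immovable_top_last w N : uniq w -> ~~ movable w -> N \in w ->
  nth 0 w 0 != N -> (forall x, x \in w -> x <= N) ->
  exists a, w = rcons a N.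
Proof.
move=> uw mw Nw hw wN; case/splitPr: Nw uw mw hw wN => a b.
case/lastP: a => [|a x]; first by rewrite eqxx.
case: b => [|y b] uw mw _ wN; first by exists (rcons a x); rewrite cats1.
case/negP: mw; rewrite cat_rcons; apply: movable_catr => /=.
apply/orP; left.
move: uw; rewrite cat_rcons cat_uniq => /and3P[_ _ /and3P[]].
rewrite !inE !negb_or => /and3P[xN xy _] /andP[Ny _] _.
have xN' : x <= N by apply: wN; rewrite mem_cat mem_rcons inE eqxx.
have yN' : y <= N by apply: wN; rewrite mem_cat !inE eqxx !orbT.
by apply: loose_peak => //; rewrite ltn_neqAle ?xN ?xN' // eq_sym Ny.
Qed.

(** The words on 1, ..., k+2 without loose window, except the decreasing one.
    Such a word has its largest letter at one of its two ends. *)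
Fixpoint vwords (k : nat) : seq (seq nat) :=
  if k is k'.+1 then
    [seq k.+2 :: w | w <- vwords k'] ++ [seq rcons w k.+2 | w <- vwords k']
  else [:: [:: 1; 2]].

Lemma size_vwords k : size (vwords k) = 2 ^ k.
Proof.
by elim: k => //= k IH; rewrite size_cat !size_map IH expnS mul2n addnn.
Qed.

Lemma mem_vwords k w : (w \in vwords k) =
  [&& perm_eq w (letters k.+2), ~~ movable w & w != letters k.+2].
Proof.
elim: k w => [|k IH] w.
  rewrite inE; apply/eqP/and3P => [->|[pw _ nw]]; first by split.
  have := perm_mem pw; have := perm_size pw; have : uniq w by rewrite (perm_uniq pw).
  case: w pw nw => [|a [|b [|c w]]] //= _ nw; rewrite inE => ab _ m.
  have := m a; have := m b.
  rewrite (_ : letters 2 = [:: 2; 1]) // !inE !eqxx ?orbT => /esym Eb /esym Ea.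
  move: nw ab; case/orP: Ea => /eqP Ea; case/orP: Eb => /eqP Eb; by subst a b.
have ltN (a : seq nat) t : perm_eq a (letters k.+2) -> t \in a -> t < k.+3.
  by move=> pa; rewrite (perm_mem pa) mem_letters => /andP[].
have two (a : seq nat) : perm_eq a (letters k.+2) -> 2 <= size a.
  by move=> /perm_size->; rewrite size_letters.
rewrite mem_cat; apply/orP/and3P.
  case=> /mapP[a]; rewrite IH => /and3P[pa ma na] ->.
    rewrite lettersS perm_cons pa (@movable_top k.+3); last first.
      by move=> t /(ltN _ _ pa)/ltnW.
    by split=> //; apply: contraNneq na => -[->].
  have sa : ~~ sorted gtn a.
    by apply: contra na => sa; apply/eqP; apply: sorted_perm_letters.
  split; first by rewrite perm_rcons lettersS perm_cons.
    apply: immovable_rcons => //; last by move=> t; apply: ltN.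
    by rewrite (perm_uniq pa) (sorted_uniq gtn_trans ltnn) ?sorted_letters.
  apply: contraNneq ma => E.
  have := two _ pa; case: a E pa {sa na} => // x a; rewrite lettersS => -[xk _] pa.
  by have := ltN _ x pa (mem_head _ _); rewrite xk ltnn.
case=> pw mw nw; have [E|hw] := eqVneq (nth 0 w 0) k.+3.
  left; case: w E pw mw nw => [|x w] //= -> pw mw nw.
  have pw' : perm_eq w (letters k.+2) by rewrite lettersS perm_cons in pw.
  rewrite map_f // IH pw' -(@movable_top k.+3); last by move=> t /(ltN _ _ pw')/ltnW.
  by rewrite mw; apply: contraNneq nw => ->; rewrite -lettersS.
right; have [|||a Ea] := @immovable_top_last w k.+3 _ mw _ hw.
- by rewrite (perm_uniq pw) (sorted_uniq gtn_trans ltnn) ?sorted_letters.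
- by rewrite (perm_mem pw) mem_letters leqnn.
- by move=> t; rewrite (perm_mem pw) mem_letters => /andP[].
have pa : perm_eq a (letters k.+2).
  by move: pw; rewrite Ea perm_rcons lettersS perm_cons.
rewrite Ea (map_f (fun v => rcons v k.+3)) // IH pa /=.
have -> : ~~ movable a.
  by apply: contra mw => ma; rewrite Ea -cats1 movable_catl.
apply: contra mw => /eqP Ea'; rewrite Ea; apply: sorted_movable_rcons.
- exact: two.
- by rewrite Ea' sorted_letters.
- by move=> t; apply: ltN.
Qed.

Lemma uniq_vwords k : uniq (vwords k).
Proof.
elim: k => //= k IH; rewrite cat_uniq !map_inj_uniq //=.
- rewrite IH andbT; apply/hasPn => _ /mapP[w wk ->].
  apply/mapP => -[w' _]; move: wk; rewrite mem_vwords => /and3P[pw _ _].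
  have := perm_size pw; rewrite size_letters; case: w pw => // x w pw _ /= [xk _].
  by have := perm_mem pw x; rewrite inE eqxx mem_letters xk ltnn andbF.
- by move=> u v /rcons_inj[].
- by move=> u v [].
Qed.

(** * Counting the labels *)

(** Cores of type T have any length from 3 to n, the others any length from
    4 to n. *)
Definition labels (n : nat) : seq (seq nat + nat * bool) :=
  [seq inl w | w <- letters n :: vwords (n - 2)] ++
  [seq inr (m, true) | m <- iota 3 (n - 2)] ++
  [seq inr (m, false) | m <- iota 4 (n - 3)].

Lemma size_labels n : 3 <= n -> size (labels n) = 2 ^ (n - 2) + 2 * n - 4.
Proof.
move=> n3; rewrite !size_cat !size_map !size_iota /= size_vwords.
by move: (2 ^ _) => e; lia.
Qed.

Lemma uniq_labels n : 2 <= n -> uniq (labels n).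
Proof.
move=> n2; rewrite /labels !cat_uniq !map_inj_uniq ?iota_uniq //=;
  try by move=> ? ? [].
have -> : letters n = letters (n - 2).+2 by congr letters; lia.
rewrite uniq_vwords mem_vwords eqxx !andbF !andbT /=.
apply/andP; split; apply/hasPn => l.
  by rewrite mem_cat => /orP[] /mapP[? _ ->]; apply/negP => /=; rewrite inE => /mapP[].
by case/mapP=> ? _ ->; apply/mapP => -[].
Qed.

(** Every active word is the core of a movable word on any alphabet 1, ..., n
    with n at least its length. *)
Lemma core_exists n m c : m <= n -> active (letters m) c ->
  exists w, [/\ perm_eq w (letters n), movable w & core w = c].
Proof.
move=> mn ac; elim: n mn => [|n IH] mn.
  exists c; case/and3P: ac => pc mc _.
  by have := movable_size mc; rewrite (perm_size pc) size_letters; case: m mn {pc}.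
move: mn; rewrite leq_eqVlt => /predU1P[mn|/IH[w [pw mw cw]]].
  subst m; clear IH; exists c; case/and3P: ac => pc mc hc; split=> //.
  case: c pc {mc} hc => //= x c pc; have [-> _ _] := letters_head pc.
  by rewrite lettersS /= => /negPf ->.
exists (n.+1 :: w); rewrite lettersS perm_cons pw (@movable_top n.+1); last first.
  by move=> t; rewrite (perm_mem pw) mem_letters => /andP[_ /leqW].
by rewrite mw /= (perm_size pw) size_letters eqxx cw.
Qed.

Lemma mem_labels n l : 3 <= n ->
  (l \in labels n) <-> (exists2 w, perm_eq w (letters n) & label w = l).
Proof.
move=> n3; have n2 : (n - 2).+2 = n by lia.
split=> [|[w pw <-{l}]].
  rewrite /labels !mem_cat => /or3P[] /mapP[].
  - move=> w wV ->; have [pw mw] : perm_eq w (letters n) /\ ~~ movable w.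
      move: wV; rewrite inE mem_vwords n2 => /predU1P[->|/and3P[//]].
      split=> //; elim: n {n3 n2} => // n IH.
      rewrite lettersS (@movable_top n.+1) // => t.
      by rewrite mem_letters => /andP[_ /leqW].
    by exists w; rewrite // /label (negPf mw).
  - move=> m; rewrite mem_iota => mb ->.
    have [k mk] : exists k, m = k.+3 by exists (m - 3); lia.
    (* The core (m-1) m (m-2) ... 1 has type T. *)
    have ac : active (letters m) [:: k.+2, k.+3, k.+1 & letters k].
      rewrite mk !lettersS; apply/and3P; split; first by perm_count.
        by apply/orP; left; apply: loose_peak => //; lia.
      by rewrite /= neq_ltn ltnSn.
    have mn : m <= n by lia.
    have [w [pw mw cw]] := core_exists mn ac.
    exists w; rewrite // /label mw cw /= size_letters mk /typeT !lettersS /=.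
    by rewrite eqxx.
  move=> m; rewrite mem_iota => mb ->.
  have [k mk] : exists k, m = k.+4 by exists (m - 4); lia.
  (* The core (m-3) (m-1) m (m-2) (m-4) ... 1 does not. *)
  have ac : active (letters m) [:: k.+1, k.+3, k.+4, k.+2 & letters k].
    rewrite mk !lettersS; apply/and3P; split; first by perm_count.
      by apply/orP; right; apply/orP; left; apply: loose_peak => //; lia.
    by rewrite /=; lia.
  have mn : m <= n by lia.
  have [w [pw mw cw]] := core_exists mn ac.
  exists w; rewrite // /label mw cw /= size_letters mk /typeT !lettersS /=.
  by congr (inr (_, _)); lia.
rewrite /label; case: ifP => mw; rewrite /labels !mem_cat.
  have ac := core_active pw mw; have mc : movable (core w) by case/and3P: ac.
  have c3 := movable_size mc.
  have cn : size (core w) <= n.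
    by rewrite -[X in _ <= X](size_letters n) -(perm_size pw) size_core.
  case T : (typeT _ _).
    apply/orP; right; apply/orP; left; apply/mapP; exists (size (core w)) => //.
    by rewrite mem_iota; lia.
  apply/orP; right; apply/orP; right; apply/mapP; exists (size (core w)) => //.
  (* An active word of three letters has type T. *)
  rewrite mem_iota; suff : size (core w) != 3 by lia.
  apply: contraFneq T => s3; rewrite s3 in ac *; rewrite !lettersS in ac *.
  exact: active3_typeT ac.
apply/orP; left; apply/mapP; exists w => //.
by rewrite inE mem_vwords n2 pw mw; case: eqP.
Qed.

(** * From words to permutations *)

Lemma nth_one_line n (p : 'S_n) (i : 'I_n) : nth 0 (one_line p) i = (p i).+1.
Proof. by rewrite (nth_map i) ?size_enum_ord // nth_ord_enum. Qed.

Lemma one_line_inj n : injective (@one_line n).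
Proof.
move=> p q E; apply/permP => i; apply/val_inj/succn_inj.
by rewrite -!nth_one_line E.
Qed.

Lemma one_line_perm n (p : 'S_n) : perm_eq (one_line p) (letters n).
Proof.
have ul : uniq (letters n) by rewrite rev_uniq iota_uniq.
have up : uniq (one_line p).
  by rewrite map_inj_uniq ?enum_uniq // => i j /succn_inj/val_inj/perm_inj.
apply: uniq_perm => //.
have sub : {subset one_line p <= letters n}.
  by move=> _ /mapP[i _ ->]; rewrite mem_letters /= ltn_ord.
by have [] := uniq_min_size up sub _; rewrite size_one_line size_letters.
Qed.

Lemma perm_one_line n w : perm_eq w (letters n) -> exists p : 'S_n, one_line p = w.
Proof. by rewrite perm_sym perm_rev perm_sym => /one_line_surj. Qed.

Lemma is_order_permP c u (s : 'S_c) :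
  reflect (size u = c /\ forall i j, i < c -> j < c ->
    (nth 0 (one_line s) i < nth 0 (one_line s) j) = (nth 0 u i < nth 0 u j))
  (is_order_perm u s).
Proof.
apply: (iffP andP) => [[/eqP su /'forall_'forall_eqP H]|[su H]].
  split=> // i j ic jc.
  by rewrite (nth_one_line s (Ordinal ic)) (nth_one_line s (Ordinal jc)) ltnS H.
split; first exact/eqP.
by apply/'forall_'forall_eqP => i j; rewrite -H // !nth_one_line ltnS.
Qed.

(** The only part of the replacement partition with several elements. *)
Definition loose_perms : {set 'S_3} :=
  perms_of_words 3 [:: [:: 2; 1; 3]; [:: 1; 3; 2]; [:: 2; 3; 1]].

Lemma loose_order x y z : loose x y z ->
  exists2 s, s \in loose_perms & is_order_perm [:: x; y; z] s.
Proof.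
have build w : w \in [:: [:: 2; 1; 3]; [:: 1; 3; 2]; [:: 2; 3; 1]] ->
    (forall i j, i < 3 -> j < 3 -> (nth 0 w i < nth 0 w j) =
       (nth 0 [:: x; y; z] i < nth 0 [:: x; y; z] j)) ->
    exists2 s, s \in loose_perms & is_order_perm [:: x; y; z] s.
  move=> wB H; have [s Es] : exists s : 'S_3, one_line s = w.
    by apply: one_line_surj; move: wB; rewrite !inE => /or3P[] /eqP->.
  by exists s; [rewrite inE Es|apply/is_order_permP; rewrite Es].
case/or3P=> H.
- by apply: (build [:: 2; 1; 3]) => // [[|[|[|i]]] [|[|[|j]]]] //= _ _; move: H; lia.
- by apply: (build [:: 1; 3; 2]) => // [[|[|[|i]]] [|[|[|j]]]] //= _ _; move: H; lia.
- by apply: (build [:: 2; 3; 1]) => // [[|[|[|i]]] [|[|[|j]]]] //= _ _; move: H; lia.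
Qed.

Lemma order_loose s u : s \in loose_perms -> is_order_perm u s ->
  exists x y z, u = [:: x; y; z] /\ loose x y z.
Proof.
rewrite inE => wB /is_order_permP[su H].
case: u su H => [|x [|y [|z [|t u]]]] // _ H.
exists x, y, z; split=> //.
have := H 0 1 isT isT; have := H 1 0 isT isT; have := H 0 2 isT isT.
have := H 2 0 isT isT; have := H 1 2 isT isT; have := H 2 1 isT isT.
move: wB; rewrite !inE /loose => {H} /or3P[] /eqP-> /=; lia.
Qed.

Lemma count_gtn_lt a b s : a < b -> a \in s -> count (gtn a) s < count (gtn b) s.
Proof.
move=> ab; have sub r : count (gtn a) r <= count (gtn b) r.
  by apply: sub_count => t /= ta; apply: ltn_trans ta ab.
elim: s => // x s IH; rewrite inE /= => /predU1P[<-|/IH lt_s].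
  by rewrite ltnn ab add0n add1n ltnS.
have le1 : (x < a) <= (x < b) by case: ltnP => // xa; rewrite (ltn_trans xa).
by rewrite -addnS leq_add.
Qed.

(** A rearrangement is determined by its order permutation: letters in the same
    position exceed equally many letters. *)
Lemma order_inj c (s : 'S_c) u v : is_order_perm u s -> is_order_perm v s ->
  perm_eq u v -> u = v.
Proof.
move=> /is_order_permP[su Hu] /is_order_permP[sv Hv] puv.
have cnt w : size w = c -> (forall i j, i < c -> j < c ->
    (nth 0 (one_line s) i < nth 0 (one_line s) j) = (nth 0 w i < nth 0 w j)) ->
    forall j, j < c -> count (gtn (nth 0 w j)) w =
      count (fun i => nth 0 (one_line s) i < nth 0 (one_line s) j) (iota 0 c).
  move=> sw Hw j jc; rewrite -[in X in count _ X](mkseq_nth 0 w) count_map sw.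
  by apply: eq_in_count => i; rewrite mem_iota /= => ic; rewrite Hw.
apply: (@eq_from_nth _ 0); first by rewrite su sv.
rewrite su => i ic; have := cnt _ sv Hv _ ic; rewrite -(cnt _ su Hu _ ic) => E.
have iu : nth 0 u i \in u by rewrite mem_nth ?su.
have iv : nth 0 v i \in v by rewrite mem_nth ?sv.
case: (ltngtP (nth 0 u i) (nth 0 v i)) => // lt_i.
  by have := count_gtn_lt lt_i iu; rewrite (seq.permP puv (gtn (nth 0 v i))) E ltnn.
by have := count_gtn_lt lt_i iv; rewrite -(seq.permP puv (gtn (nth 0 u i))) E ltnn.
Qed.

Lemma same_part_loose x y z x' y' z' : loose x y z -> loose x' y' z' ->
  same_part K_213_132_231 [:: x; y; z] [:: x'; y'; z'].
Proof.
move=> /loose_order[s sB su] /loose_order[t tB tv].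
apply/exists_inP; exists loose_perms; first by rewrite !inE eqxx.
by apply/exists_inP; exists s => //; apply/exists_inP; exists t; rewrite ?su.
Qed.

Lemma same_part_inv u v : perm_eq u v -> same_part K_213_132_231 u v ->
  u = v \/ exists x y z x' y' z',
     [/\ u = [:: x; y; z], v = [:: x'; y'; z'], loose x y z & loose x' y' z'].
Proof.
move=> puv /exists_inP[B KB /exists_inP[s sB /exists_inP[t tB /andP[us vt]]]].
move: KB; rewrite !inE => /orP[/eqP EB|/imsetP[r _ EB]]; subst B.
  right; have [x [y [z [-> B]]]] := order_loose sB us.
  have [x' [y' [z' [-> B']]]] := order_loose tB vt.
  by exists x, y, z, x', y', z'.
left; move: sB tB; rewrite !inE => /eqP Es /eqP Et; subst s t.
exact: order_inj us vt puv.
Qed.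

Lemma step_catl a u v : step u v -> step (a ++ u) (a ++ v).
Proof. by elim: a => //= x a IH /IH; apply: step_cons. Qed.

Lemma step_split u v : step u v -> exists a x y z x' y' z' b,
  [/\ u = a ++ [:: x; y; z] ++ b, v = a ++ [:: x'; y'; z'] ++ b,
    loose x y z & loose x' y' z'].
Proof.
elim=> {u v} [x y z x' y' z' w B B' _|
    c u v _ [a [x [y [z [x' [y' [z' [w [-> -> B B']]]]]]]]]].
  by exists [::], x, y, z, x', y', z', w.
by exists (c :: a), x, y, z, x', y', z', w.
Qed.

Lemma step_K_step n (p q : 'S_n) :
  step (one_line p) (one_line q) -> K_step K_213_132_231 p q.
Proof.
case/step_split=> [a [x [y [z [x' [y' [z' [b [Ep Eq B B']]]]]]]]].
apply/K_stepP; exists a, [:: x; y; z], [:: x'; y'; z'], b.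
by split=> //; apply: same_part_loose.
Qed.

Lemma K_step_step n (p q : 'S_n) :
  K_step K_213_132_231 p q -> p = q \/ step (one_line p) (one_line q).
Proof.
case/K_stepP=> [a [u [v [b [Ep Eq _ _ uv]]]]].
have puv : perm_eq u v.
  have : perm_eq (one_line p) (one_line q).
    by rewrite (perm_trans (one_line_perm p)) // perm_sym one_line_perm.
  by rewrite Ep Eq perm_cat2l perm_cat2r.
have [E|[x [y [z [x' [y' [z' [Eu Ev B B']]]]]]]] := same_part_inv puv uv.
  by left; apply: one_line_inj; rewrite Ep Eq E.
by right; rewrite Ep Eq Eu Ev; apply: step_catl; apply: step_head; rewrite // -Eu -Ev.
Qed.

Lemma eqv_perm u v : eqv u v -> perm_eq u v.
Proof.
elim=> {u v} [u v||u v _|u w v _ uw _] //; first exact: step_perm.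
  by rewrite perm_sym.
exact: perm_trans.
Qed.

Lemma eqv_K_equiv n (p q : 'S_n) :
  eqv (one_line p) (one_line q) -> K_equiv K_213_132_231 p q.
Proof.
move: {2}(one_line p) {2}(one_line q) (erefl (one_line p)) (erefl (one_line q)).
move=> u v Eu Ev; rewrite Eu Ev => uv.
elim: uv p q Eu Ev => {u v} [u v uv|u|u v _ IH|u w v uw IH1 _ IH2] p q Ep Eq.
- by apply: connect1; apply: step_K_step; rewrite Ep Eq.
- by rewrite (one_line_inj (etrans Ep (esym Eq))); apply: connect0.
- rewrite /K_equiv (sym_connect_sym (@K_step_sym _ _ _)); exact: IH.
have [r Er] : exists r : 'S_n, one_line r = w.
  apply: perm_one_line; rewrite (perm_trans _ (one_line_perm p)) // Ep.
  by rewrite perm_sym; apply: eqv_perm.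
by apply: connect_trans (IH1 _ _ Ep Er) (IH2 _ _ Er Eq).
Qed.

(** The label of the one-line word is a complete invariant of the class. *)
Lemma K_equiv_label n (p q : 'S_n) :
  K_equiv K_213_132_231 p q = (label (one_line p) == label (one_line q)).
Proof.
apply/idP/eqP => [/connectP[r pr ->] {q}|E]; last first.
  by apply/eqv_K_equiv/(label_complete (one_line_perm p) (one_line_perm q)).
elim: r p pr => //= q r IH p /andP[/K_step_step pq /IH <-].
by case: pq => [->|/(label_step (one_line_perm p))].
Qed.

(** The classes of the kernel of [f] are as many as the values of [f]. *)
Lemma card_kernel_partition (T : finType) (rT : eqType) (f : T -> rT) (r : rel T)
    (s : seq rT) :
  (forall x y, r x y = (f x == f y)) -> uniq s ->
  (forall l, l \in s <-> exists x, f x = l) ->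
  #|equivalence_partition r [set: T]| = size s.
Proof.
move=> rE us ims; pose cls l := [set y | f y == l].
rewrite cardE -(size_map cls s); apply: perm_size; apply: uniq_perm.
- exact: enum_uniq.
- rewrite map_inj_in_uniq // => l l' /ims[x <-] _ /setP/(_ x).
  by rewrite !inE eqxx => /esym/eqP.
move=> B; rewrite mem_enum; apply/imsetP/mapP => [[x _ ->]|[l /ims[x <-] ->]].
  exists (f x); first by apply/ims; exists x.
  by apply/setP=> y; rewrite !inE rE eq_sym.
by exists x => //; apply/setP=> y; rewrite !inE rE eq_sym.
Qed.

Theorem theorem2p37 (n : nat) (hn : 3 <= n) :
  #|K_classes K_213_132_231 n| = 2 ^ (n - 2) + 2 * n - 4.
Proof.
rewrite -size_labels //.
apply: (@card_kernel_partition _ _ (fun p => label (one_line p))).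
- exact: K_equiv_label.
- exact: uniq_labels (ltnW hn).
move=> l; rewrite mem_labels //; split=> [[w pw <-]|[p <-]].
  by have [p <-] := perm_one_line pw; exists p.
by exists (one_line p); rewrite ?one_line_perm.
Qed.
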